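(* Let $k > p > 1$ be integers. Then the limit $\lim_{m \to \infty} \frac{c_p^k(m)}{m^{(p-1)/(k-1)}}$ (over integers $m$) exists and $$\lim_{m \to \infty} \frac{c_p^k(m)}{m^{\frac{p-1}{k-1}}} = \frac{((k-1)!)^{\frac{p-1}{k-1}}}{(p-1)!}.$$
   Context: Binomial coefficients follow the convention $\binom{n}{j} = 0$ if $n < j$. For an integer $m > 0$, $g_k(m)$ is the unique integer with $\binom{g_k(m)}{k-1} \le m < \binom{g_k(m)+1}{k-1}$. The function $c_p^k$ is defined on integers $m \ge 0$ recursively by $c_p^k(0) = 0$ and $c_p^k(m) = \binom{g_k(m)}{p-1} + c_p^k\!\left(m - \binom{g_k(m)}{k-1}\right)$ for $m > 0$. *)

(* Defs.v *)
From HB Require Import structures.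
From mathcomp Require Import all_boot all_order all_algebra.
From mathcomp Require Import all_classical all_reals all_analysis.

Set Implicit Arguments.
Unset Strict Implicit.
Unset Printing Implicit Defensive.

Local Open Scope nat_scope.

Definition g_spec (k m n : nat) : bool :=
  'C(n, k - 1) <= m < 'C(n.+1, k - 1).

(* Existence and uniqueness, for k > 1 and m > 0, are [gP] and [g_unique];
   negative integers never satisfy the defining inequalities when m > 0. *)
Definition g (k m : nat) : nat := xget 0 [set n | g_spec k m n]%classic.

(* The first argument bounds the depth of the recursion; since every step
   decreases m, the bound m used in [c] suffices (see [c_rec]). *)
Fixpoint c_fuel (fuel p k m : nat) : nat :=
  if fuel is fuel'.+1 then
    if m == 0 then 0
    else 'C(g k m, p - 1) + c_fuel fuel' p k (m - 'C(g k m, k - 1))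
  else 0.

Definition c (p k m : nat) : nat := c_fuel m p k m.

Lemma g_exists k m : 1 < k -> 0 < m -> exists n, g_spec k m n.
Proof.
move=> k1 m0.
have [j kE] : exists j, k - 1 = j.+1.
  by exists k.-2; case: k k1 => [|[|k]] //= _; rewrite subn1.
have ex : exists n, m < 'C(n.+1, k - 1).
  exists (m + j); rewrite kE; elim: (m) => [|i IH]; first by rewrite binn.
  rewrite addSn binS; apply: leq_ltn_trans IH _.
  by rewrite -addn1 leq_add2l bin_gt0 leqW // leq_addl.
case: (ex_minnP ex) => n Pn minn; exists n; rewrite /g_spec Pn andbT leqNgt.
apply/negP => lt_m; case: n => [|n] in Pn minn lt_m *.
  by move: lt_m; rewrite kE bin0n.
by have := minn n lt_m; rewrite ltnn.
Qed.

Lemma g_unique k m n1 n2 : g_spec k m n1 -> g_spec k m n2 -> n1 = n2.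
Proof.
wlog le12 : n1 n2 / n1 <= n2.
  by move=> W s1 s2; case: (leqP n1 n2) => [|/ltnW] h;
    [exact: W | apply/esym; exact: W].
move=> /andP[_ b1] /andP[b2 _]; apply/eqP; rewrite eqn_leq le12 leqNgt.
apply/negP => lt12; have := leq_trans b1 (leq_bin2l (k - 1) lt12).
by rewrite ltnNge b2.
Qed.

Lemma gP k m : 1 < k -> 0 < m -> g_spec k m (g k m).
Proof.
move=> k1 m0; have [n sn] := g_exists k1 m0.
exact: (@xgetPex _ 0 [set n | g_spec k m n]%classic (ex_intro _ n sn)).
Qed.

Lemma bin_g_gt0 k m : 1 < k -> 0 < m -> 0 < 'C(g k m, k - 1).
Proof.
move=> k1 m0; have /andP[_ lt_m] := gP k1 m0.
rewrite bin_gt0 leqNgt; apply/negP => lt_g.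
move: lt_m; rewrite leq_eqVlt in lt_g; case/orP: lt_g => [/eqP <-|lt_g].
  by rewrite binn ltnS leqNgt m0.
by rewrite bin_small.
Qed.

Lemma c0 p k : c p k 0 = 0.
Proof. by []. Qed.

Lemma c_fuelE p k m f1 f2 : 1 < k -> m <= f1 -> m <= f2 ->
  c_fuel f1 p k m = c_fuel f2 p k m.
Proof.
move=> k1; elim: f1 f2 m => [|f1 IH] [|f2] [|m] //= le1 le2.
congr (_ + _); have lt := bin_g_gt0 k1 (ltn0Sn m).
by apply: IH; rewrite leq_subLR; [apply: leq_trans le1 _ | apply: leq_trans le2 _];
  rewrite -add1n leq_add2r.
Qed.

Lemma c_rec p k m : 1 < k -> 0 < m ->
  c p k m = 'C(g k m, p - 1) + c p k (m - 'C(g k m, k - 1)).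
Proof.
case: m => // m k1 _; rewrite {1}/c /=; congr (_ + _).
apply: c_fuelE => //; rewrite leq_subLR -add1n leq_add2r.
exact: bin_g_gt0.
Qed.

(* Main.v *)
(* Put q = k - 1, r = p - 1 and g = g_k(m). The residue m' = m - 'C(g, q) is at
   most g ^ (q - 1), so the next index h = g_k(m') satisfies
   h ^ q <= q ^ q * q! * g ^ (q - 1), whence h = o(g). By strong induction
   c(m) = O(g ^ r), and therefore c(m') = O(h ^ r) = o(g ^ r): only the first
   term 'C(g, r) ~ g ^ r / r! of c(m) matters, while m ~ g ^ q / q!. *)

Require Import Defs.
From HB Require Import structures.
From mathcomp Require Import all_boot all_order all_algebra.
From mathcomp Require Import all_classical all_reals all_analysis.
From mathcomp Require Import zify.

Set Implicit Arguments.
Unset Strict Implicit.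
Unset Printing Implicit Defensive.

Import Order.TTheory GRing.Theory Num.Theory.
Import numFieldNormedType.Exports.

(** * Comparison of binomial coefficients with powers *)

Lemma leq_ffact_expn n j : n ^_ j <= n ^ j.
Proof.
by elim: j => // j IH; rewrite ffactnSr expnSr leq_mul // leq_subr.
Qed.

Lemma leq_bin_expn n j : 'C(n, j) <= n ^ j.
Proof.
apply: leq_trans (leq_ffact_expn n j).
by rewrite -bin_ffact leq_pmulr // fact_gt0.
Qed.

(** The comparison is made factor by factor in [n ^_ q]: for [j < q <= n], one has
    [n <= q * (n - j)]. *)
Lemma leq_expn_bin n q : q <= n -> n ^ q <= q ^ q * q`! * 'C(n, q).
Proof.
move=> le_qn; rewrite -mulnA [q`! * _]mulnC bin_ffact.
suff W j : j <= q -> n ^ j <= q ^ j * n ^_ j by exact: W.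
elim: j => // j IH lt_jq.
rewrite !expnSr ffactnSr mulnACA leq_mul ?IH ?(ltnW lt_jq) //.
have [d ->] : exists d, n = d.+1 + j by exists (n - j).-1; lia.
rewrite addnK; nia.
Qed.

(** * Bounds for the greedy index, the residue and [c] *)

Section Greedy.
Variable q : nat.
Hypothesis q_gt1 : 1 < q.

Let k_gt1 : 1 < q.+1. Proof. exact: leqW. Qed.

Lemma g_bounds m : 0 < m -> 'C(g q.+1 m, q) <= m < 'C((g q.+1 m).+1, q).
Proof. by move=> m_gt0; have := gP k_gt1 m_gt0; rewrite /g_spec subn1. Qed.

Lemma g_ge m : 0 < m -> q <= g q.+1 m.
Proof.
by move=> m_gt0; have := bin_g_gt0 k_gt1 m_gt0; rewrite subn1 bin_gt0.
Qed.

Lemma g_ge_of_expn_le N m : 0 < m -> N ^ q <= m -> N <= g q.+1 m.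
Proof.
move=> m_gt0 le_m; rewrite leqNgt; apply/negP => lt_gN.
have /andP[_] := g_bounds m_gt0; rewrite ltnNge => /negP; apply.
by rewrite (leq_trans (leq_bin2l q lt_gN)) // (leq_trans (leq_bin_expn _ _)).
Qed.

Definition residue m := m - 'C(g q.+1 m, q).

Lemma residue_lt m : 0 < m -> residue m < m.
Proof.
move=> m_gt0; have := bin_g_gt0 k_gt1 m_gt0; rewrite subn1 /= /residue; lia.
Qed.

(* By Pascal's rule, the gap between 'C(g, q) and 'C(g.+1, q) is 'C(g, q.-1). *)
Lemma residue_le m : 0 < m -> residue m <= g q.+1 m ^ q.-1.
Proof.
move=> m_gt0; have /andP[le_m lt_m] := g_bounds m_gt0.
apply: leq_trans (leq_bin_expn _ _); rewrite leq_subLR; apply: ltnW.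
move: lt_m; rewrite -[in X in X -> _](ltn_predK q_gt1) binS.
by rewrite (ltn_predK q_gt1).
Qed.

(** This makes h = o(g) quantitative. After raising to the power [q], one factor of [g ^ q] absorbs
    the constant and the other [q.-1] bound the residue. *)
Lemma g_residue_small N m : 0 < N -> 0 < m -> 0 < residue m ->
  N ^ q * (q ^ q * q`!) <= g q.+1 m -> N * g q.+1 (residue m) <= g q.+1 m.
Proof.
move=> N_gt0 m_gt0 m'_gt0 le_g; set h := g _ (residue m).
rewrite -(leq_exp2r _ _ (ltnW q_gt1)) expnMn.
have le_h := leq_expn_bin (g_ge m'_gt0).
have /andP[le_m' _] := g_bounds m'_gt0.
have le_r := residue_le m_gt0.
rewrite -[X in _ <= _ ^ X](ltn_predK q_gt1) expnS.
apply: leq_trans (leq_mul le_g le_r).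
by rewrite -mulnA leq_mul // (leq_trans le_h) // leq_mul.
Qed.

Variable r : nat.
Hypothesis r_gt0 : 0 < r.

Lemma c_residue m : 0 < m ->
  c r.+1 q.+1 m = 'C(g q.+1 m, r) + c r.+1 q.+1 (residue m).
Proof. by move=> m_gt0; rewrite (c_rec _ k_gt1) // !subn1. Qed.

(** Once g >= [G], the next index h is at most g / 2, so K * h ^ r is at most half of K * g ^ r. The
    other half pays for the leading binomial, at most g ^ r, as soon as K >= 2. *)
Lemma c_le_g : exists K, forall m, 0 < m -> c r.+1 q.+1 m <= K * g q.+1 m ^ r.
Proof.
pose G := 2 ^ q * (q ^ q * q`!).
(* If g < [G] then [m < G ^ q], so [S] bounds all the values of [c] in the base case. *)
pose S := \sum_(i < G ^ q) c r.+1 q.+1 i.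
exists S.+2; elim/ltn_ind => m IH m_gt0.
have g_gt0 : 0 < g q.+1 m by apply: leq_trans (g_ge m_gt0); apply: ltnW.
have [lt_gG|le_Gg] := ltnP (g q.+1 m) G.
  have lt_mG : m < G ^ q.
    by rewrite ltnNge; apply/negP => /(g_ge_of_expn_le m_gt0);
      rewrite leqNgt lt_gG.
  rewrite (leq_trans (n := S.+2)) ?leq_pmulr ?expn_gt0 ?g_gt0 //.
  by rewrite /S (bigD1 (Ordinal lt_mG)) //= -addnS -addnS leq_addr.
rewrite c_residue //.
have le_bin := leq_bin_expn (g q.+1 m) r.
have [m'0|m'_gt0] := posnP (residue m); first by rewrite m'0 c0 addn0; nia.
have le_h := g_residue_small (isT : 0 < 2) m_gt0 m'_gt0 le_Gg.
have IHm := IH _ (residue_lt m_gt0) m'_gt0.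
have le_hr : 2 * g q.+1 (residue m) ^ r <= g q.+1 m ^ r.
  apply: (@leq_trans ((2 * g q.+1 (residue m)) ^ r)); last by rewrite leq_exp2r.
  by rewrite expnMn leq_mul // -[X in X <= _](expn1 2) leq_pexp2l.
nia.
Qed.

Lemma c_residue_small N : 0 < N -> exists M, forall m, M <= m ->
  N * c r.+1 q.+1 (residue m) <= g q.+1 m ^ r.
Proof.
move=> N_gt0; have [K cK] := c_le_g.
(* The chain is N * c(m') <= N * K * h ^ r <= L * h ^ r <= (L * h) ^ r <= g ^ r; the successor keeps
   [L] positive even when [K = 0]. *)
pose L := N * K.+1.
have L_gt0 : 0 < L by rewrite muln_gt0 N_gt0.
exists ((L ^ q * (q ^ q * q`!)) ^ q).+1 => m lt_m.
have m_gt0 : 0 < m by apply: leq_trans lt_m.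
have [-> |m'_gt0] := posnP (residue m); first by rewrite c0 muln0.
have le_h : L * g q.+1 (residue m) <= g q.+1 m.
  apply: g_residue_small => //.
  exact: g_ge_of_expn_le (ltnW lt_m).
apply: (@leq_trans ((L * g q.+1 (residue m)) ^ r)); last by rewrite leq_exp2r.
rewrite expnMn (leq_trans (leq_mul (leqnn N) (cK _ m'_gt0))) //.
rewrite mulnA leq_mul //.
rewrite (leq_trans (n := L)) ?leq_mul // -[X in X <= _](expn1 L).
exact: leq_pexp2l.
Qed.

End Greedy.

Local Open Scope classical_set_scope.
Local Open Scope ring_scope.

(** * Limits of binomial coefficients divided by powers *)

Section Limits.
Variable R : realType.

Lemma cvg_natV : (n%:R^-1 : R) @[n --> \oo] --> (0 : R).
Proof. rewrite -cvg_shiftS; exact: cvg_harmonic. Qed.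

Lemma cvg_bin_expn j :
  ('C(n, j)%:R / n%:R ^+ j : R) @[n --> \oo] --> (j`!%:R^-1 : R).
Proof.
have fj0 : j`!%:R != 0 :> R by rewrite pnatr_eq0 -lt0n fact_gt0.
(* For the falling factorial the limit is 1, since each further factor (n - j) / n tends to 1. *)
suff W : ((n ^_ j)%:R / n%:R ^+ j : R) @[n --> \oo] --> (1 : R).
  rewrite -[X in _ --> X]mul1r; apply: cvg_trans (cvgMr_tmp W).
  apply: near_eq_cvg; near=> n => /=.
  by rewrite -bin_ffact natrM mulrAC mulfK.
elim: j {fj0} => [|j IH].
  under eq_fun do rewrite ffactn0 expr0 divr1.
  exact: cvg_cst.
have one : (1 - j%:R * n%:R^-1 : R) @[n --> \oo] --> (1 : R).
  rewrite -[X in _ --> X]subr0 -[X in _ --> _ - X](mulr0 (j%:R)).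
  by apply: cvgB; [exact: cvg_cst | exact: cvgMl_tmp cvg_natV].
rewrite -[X in _ --> X]mulr1; apply: cvg_trans (cvgM IH one).
apply: near_eq_cvg; near=> n => /=.
have le_jn : (j < n)%N by near: n; exact: nbhs_infty_gt.
have n0 : n%:R != 0 :> R by rewrite pnatr_eq0 -lt0n (leq_trans _ le_jn).
rewrite ffactnSr natrM natrB 1?ltnW // exprSr invfM mulrACA mulrBl.
by rewrite mulfV.
Unshelve. all: by end_near.
Qed.

Lemma cvg_binS_expn j :
  ('C(n.+1, j)%:R / n%:R ^+ j : R) @[n --> \oo] --> (j`!%:R^-1 : R).
Proof.
have W : ('C(n.+1, j)%:R / n.+1%:R ^+ j : R) @[n --> \oo] --> (j`!%:R^-1 : R).
  by rewrite (cvg_shiftS (fun n => 'C(n, j)%:R / n%:R ^+ j : R));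
     exact: cvg_bin_expn.
have one : ((1 + n%:R^-1) ^+ j : R) @[n --> \oo] --> (1 : R).
  have one : (1 + n%:R^-1 : R) @[n --> \oo] --> (1 : R).
    rewrite -[X in _ --> X]addr0.
    by apply: cvgD; [exact: cvg_cst | exact: cvg_natV].
  rewrite -[X in _ --> X](expr1n _ j).
  exact: cvg_comp one (@exprn_continuous _ j _).
rewrite -[X in _ --> X]mulr1; apply: cvg_trans (cvgM W one).
apply: near_eq_cvg; near=> n => /=.
have n_gt0 : (0 < n)%N by near: n; exact: nbhs_infty_gt.
have n0 : n%:R != 0 :> R by rewrite pnatr_eq0 -lt0n.
have n1 : n.+1%:R != 0 :> R by rewrite pnatr_eq0.
have -> : 1 + n%:R^-1 = n.+1%:R / n%:R :> R.
  by rewrite -natr1 mulrDl mulfV // mul1r.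
by rewrite expr_div_n mulrA divfK // expf_neq0.
Unshelve. all: by end_near.
Qed.

(** * Asymptotics of [m] and [c] in terms of the greedy index *)

Variable q : nat.
Hypothesis q_gt1 : (1 < q)%N.

Lemma cvg_g : g q.+1 m @[m --> \oo] --> \oo.
Proof.
apply/cvgnyPge => A; near=> m.
apply: (g_ge_of_expn_le q_gt1); near: m; first exact: nbhs_infty_gt.
exact: nbhs_infty_ge.
Unshelve. all: by end_near.
Qed.

(** Squeeze: divide the inequalities defining g by g ^ q; both bounds tend to 1 / q! because g tends
    to infinity. *)
Lemma cvg_g_expn :
  (m%:R / (g q.+1 m)%:R ^+ q : R) @[m --> \oo] --> (q`!%:R^-1 : R).
Proof.
apply: (squeeze_cvgr _ (cvg_comp _ _ cvg_g (@cvg_bin_expn q))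
   (cvg_comp _ _ cvg_g (@cvg_binS_expn q))).
near=> m => /=.
have m_gt0 : (0 < m)%N by near: m; exact: nbhs_infty_gt.
have /andP[le_m /ltnW lt_m] := g_bounds q_gt1 m_gt0.
by rewrite !ler_wpM2r ?ler_nat // invr_ge0 exprn_ge0.
Unshelve. all: by end_near.
Qed.

Variable r : nat.
Hypothesis r_gt0 : (0 < r)%N.

Lemma cvg_c_residue :
  ((c r.+1 q.+1 (residue q m))%:R / (g q.+1 m)%:R ^+ r : R) @[m --> \oo] -->
  (0 : R).
Proof.
apply/cvgr0Pnorm_le => e e_gt0.
(* [N] is chosen with 1 / (N + 1) < e, and the bound on the residue is then used with the factor
   [N.+1]. *)
have [N _ leN] := near_infty_natSinv_lt (PosNum e_gt0).
have {leN} := leN N (leqnn N) => /= /ltW leN.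
have [M leM] := c_residue_small q_gt1 r_gt0 (ltn0Sn N).
near=> m.
have m_gt0 : (0 < m)%N by near: m; exact: nbhs_infty_gt.
have g_gt0 : (0 : R) < (g q.+1 m)%:R ^+ r.
  by rewrite exprn_gt0 // ltr0n (leq_trans _ (g_ge q_gt1 m_gt0)) // ltnW.
rewrite ger0_norm ?divr_ge0 ?(ltW g_gt0) //; apply: le_trans leN.
rewrite ler_pdivrMr // mulrC ler_pdivlMr // mulrC -natrX -natrM ler_nat.
by apply: leM; near: m; exact: nbhs_infty_ge.
Unshelve. all: by end_near.
Qed.

Lemma cvg_c_expn :
  ((c r.+1 q.+1 m)%:R / (g q.+1 m)%:R ^+ r : R) @[m --> \oo] -->
  (r`!%:R^-1 : R).
Proof.
rewrite -[X in _ --> X]addr0.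
apply: cvg_trans (cvgD (cvg_comp _ _ cvg_g (@cvg_bin_expn r)) cvg_c_residue).
apply: near_eq_cvg; near=> m => /=.
have m_gt0 : (0 < m)%N by near: m; exact: nbhs_infty_gt.
by rewrite fctE /= -mulrDl -natrD -c_residue.
Unshelve. all: by end_near.
Qed.

Lemma powR_continuous (s x : R) :
  0 < x -> {for x, continuous (fun a : R => a `^ s)}.
Proof.
move=> x_gt0; apply: differentiable_continuous; apply/derivable1_diffP.
by apply: derivable_powR; rewrite in_itv /= x_gt0.
Qed.

(** With s = r / q, (g ^ q) ^ s = g ^ r, so c / m ^ s is the product of c / g ^ r and the inverse of
    (m / g ^ q) ^ s. The power function is continuous at the positive limit 1 / q!. *)
Lemma cvg_c_powR :
  ((c r.+1 q.+1 m)%:R / (m%:R `^ (r%:R / q%:R)) : R) @[m --> \oo] -->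
  ((q`!%:R `^ (r%:R / q%:R)) / r`!%:R : R).
Proof.
have fq : 0 < q`!%:R^-1 :> R by rewrite invr_gt0 ltr0n fact_gt0.
have W := cvg_comp _ _ cvg_g_expn (powR_continuous (s := r%:R / q%:R) fq).
have -> : q`!%:R `^ (r%:R / q%:R) / r`!%:R =
    r`!%:R^-1 * (q`!%:R^-1 `^ (r%:R / q%:R))^-1 :> R.
  by rewrite -[q`!%:R^-1]powR_inv1 // -powRrM mulN1r powRN invrK mulrC.
apply: cvg_trans (cvgM cvg_c_expn (cvgV (lt0r_neq0 (powR_gt0 _ fq)) W)).
apply: near_eq_cvg; near=> m => /=.
have m_gt0 : (0 < m)%N by near: m; exact: nbhs_infty_gt.
have g_gt0 : (0 : R) < (g q.+1 m)%:R.
  by rewrite ltr0n (leq_trans _ (g_ge q_gt1 m_gt0)) // ltnW.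
have q0 : q%:R != 0 :> R by rewrite pnatr_eq0 -lt0n ltnW.
rewrite powRM ?invr_ge0 ?exprn_ge0 // -[X in (X^-1) `^ _]powR_mulrn //.
rewrite -powRN -powRrM mulNr mulrCA mulfV // mulr1 powRN powR_mulrn //.
by rewrite invfM invrK mulrACA mulVf ?mulr1 // expf_neq0 // gt_eqF.
Unshelve. all: by end_near.
Qed.

End Limits.

Theorem theorem2p12 (R : realType) (p k : nat) (hp : (1 < p)%N) (hk : (p < k)%N) :
  ((c p k m)%:R / (m%:R `^ ((p - 1)%:R / (k - 1)%:R)) : R) @[m --> \oo] -->
  (((k - 1)`!%:R `^ ((p - 1)%:R / (k - 1)%:R)) / (p - 1)`!%:R : R).
Proof.
case: p k hp hk => [|r] [|q] // r_gt0 lt_rq; rewrite !subn1 /=.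
apply: cvg_c_powR => //; exact: (@leq_ltn_trans r).
Qed.
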